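(* Let $f:\mathbb{N}\to\mathbb{Z}$ be a map which is continuous with respect to the Furstenberg topology (on $\mathbb{Z}$, and the induced subspace topology on $\mathbb{N}$), and which is unbounded on every congruence class, i.e. for all integers $a,b$ with $b>0$ the set $\{f(n) : n\in\mathbb{N},\ n\equiv a \pmod b\}$ is unbounded. Then the sequence $\{f(n)\}_{n=1}^{\infty}$ has infinitely many prime divisors.
   Context: $\mathbb{N}$ denotes the set of positive integers. For $a,b\in\mathbb{Z}$ with $b>0$, let $Con(a,b)=\{x\in\mathbb{Z} : x\equiv a \pmod b\}$. The Furstenberg topology $\mathcal{F}$ on $\mathbb{Z}$ is the topology having the classes $Con(a,b)$ ($a,b\in\mathbb{Z}$, $b>0$) as a basis of open sets. $\mathbb{Z}$ is endowed with $\mathcal{F}$ and $\mathbb{N}$ with the subspace topology. A prime $p$ is called a prime divisor of a sequence of integers if $p$ divides some term of the sequence. *)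

(* Defs.v *)
From HB Require Import structures.
From mathcomp Require Import all_boot all_order all_algebra.
From mathcomp Require Import all_classical topology.
From mathcomp Require Import ring.

Set Implicit Arguments.
Unset Strict Implicit.
Unset Printing Implicit Defensive.

Import Order.TTheory GRing.Theory Num.Theory.

Local Open Scope classical_set_scope.
Local Open Scope ring_scope.

Definition Con (a b : int) : set int := [set x | (x = a %[mod b])%Z].

(* An alias of int, so that the Furstenberg topology is not put on int
   itself. *)
Definition furstenberg : Type := int.

HB.instance Definition _ := Choice.on furstenberg.
HB.instance Definition _ := isPointed.Build furstenberg (0 : int).

Definition Con_index : set (furstenberg * furstenberg) :=
  [set ab | 0 < ab.2 :> int].

Definition Con_base (ab : furstenberg * furstenberg) : set furstenberg :=
  Con ab.1 ab.2.

Lemma Con_base_cover : \bigcup_(ab in Con_index) Con_base ab = setT.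
Proof. by apply/seteqP; split=> // x _; exists (x, 1 : int). Qed.

Lemma Con_base_join i j t : Con_index i -> Con_index j ->
  Con_base i t -> Con_base j t ->
  exists k, [/\ Con_index k, Con_base k t &
    Con_base k `<=` Con_base i `&` Con_base j].
Proof.
case: i j => [a b] [c d]; rewrite /Con_index /Con_base /Con /=.
move=> b0 d0 tb td; exists (t, b * d : int); split=> //=; first exact: mulr_gt0.
move=> x /= /eqP; rewrite eqz_mod_dvd => /dvdzP[q xt].
have -> : x = t + q * (b * d) by rewrite -xt addrC subrK.
rewrite -tb -td; split; rewrite addrC.
  by rewrite (_ : q * _ = q * d * b) ?modzMDl //; ring.
by rewrite mulrA modzMDl.
Qed.

HB.instance Definition _ :=
  isBaseTopological.Build furstenberg Con_base_cover Con_base_join.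

Lemma open_furstenbergP (U : set furstenberg) :
  open U <-> forall x : int, U x -> exists2 b : int, 0 < b & Con x b `<=` U.
Proof.
split=> [[D' D'D <-] x [[a b] D'ab /= xab]|H].
  exists b => [|y xyb]; first exact: D'D D'ab.
  by exists (a, b) => //; rewrite /Con_base /Con /= xyb.
exists [set ab | Con_index ab /\ Con_base ab `<=` U]; first by move=> ? [].
apply/seteqP; split=> [x [ab [_ +]]|x Ux]; first exact.
by have [b b0 xbU] := H x Ux; exists (x, b).
Qed.

(* The positive integers; as a type, it carries the library's subspace
   topology of set_type, the initial topology of its inclusion into
   furstenberg. *)
Definition posint : set furstenberg := [set n | 0 < n :> int].

Definition bounded_int (A : set int) : Prop :=
  exists M : int, forall x, A x -> `|x| <= M.

Definition prime_divisors (f : posint -> int) : set nat :=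
  [set p | prime p /\ exists n : posint, (p%:Z %| f n)%Z].

(* Main.v *)
Require Import Defs.
From mathcomp Require Import all_boot all_order all_algebra.
From mathcomp Require Import all_classical topology.
From mathcomp Require Import ring.

(** Suppose the set of prime divisors is finite, with product [P], and pick [n0]
    with [m = f n0] nonzero. By continuity there is [b > 0] such that
    [n = n0 mod b] forces [f n = m mod m P], i.e. [f n = m (1 + k P)]. A prime
    dividing [1 + k P] divides [f n], hence [P], hence [1]; so [1 + k P] is a
    unit and [|f n| = |m|] on the whole class of [n0] modulo [b]. *)

Import Order.TTheory GRing.Theory Num.Theory.

Local Open Scope classical_set_scope.
Local Open Scope ring_scope.

Lemma dvdn_prod_seq (s : seq nat) (p : nat) :
  p \in s -> (p %| \prod_(q <- s) q)%N.
Proof. by move=> ps; rewrite (big_rem p) //= dvdn_mulr. Qed.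

(* Unlike [pdiv], this also covers [n = 0]. *)
Lemma prime_dvdn_neq1 (n : nat) : n != 1%N -> exists2 p, prime p & (p %| n)%N.
Proof.
case: n => [_|[//|n] _]; first by exists 2%N.
by exists (pdiv n.+2); rewrite ?pdiv_prime ?pdiv_dvd.
Qed.

(** The preimage of the open class of [f n0] modulo [c] is the trace on [posint] of an open set [V]
    of integers, and [V] contains a whole class around [n0]. *)
Lemma continuous_posint_Con (f : posint -> furstenberg) (n0 : posint) (c : int) :
  continuous f -> 0 < c ->
  exists2 b : int, 0 < b &
    forall n : posint, Con (\val n0) b (\val n) -> Con (f n0) c (f n).
Proof.
move=> /continuousP fC c0.
have /fC[V Vo VE] : open (Con (f n0) c : set furstenberg).
  by apply/open_furstenbergP => x xc; exists c => // y; rewrite /Con /= xc.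
have preE n : V (\val n) = Con (f n0) c (f n).
  by have := congr1 (@^~ n) VE.
have Vn0 : V (\val n0) by rewrite preE.
have /open_furstenbergP/(_ _ Vn0)[b b0 bV] := Vo.
by exists b => // n /bV; rewrite preE.
Qed.

Theorem theorem2p1 (f : posint -> furstenberg)
    (f_continuous : continuous f)
    (f_unbounded : forall a b : int, 0 < b ->
       ~ bounded_int [set f n | n in [set n : posint | Con a b (\val n)]]) :
  infinite_set (prime_divisors f).
Proof.
move=> /finite_seqP[s sE].
have {}sE p : prime_divisors f p = (p \in s) by have := congr1 (fun A : set nat => A p) sE.
have [n0 fn0] : exists n0, (f n0 : int) != 0.
  (* Otherwise [f] is identically zero, hence bounded on the class of 0 modulo 1, which is
     everything. *)
  apply: contrapT => f0; apply: (f_unbounded 0 1) => //.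
  exists 0 => _ [n _ <-]; have [->|fn] := eqVneq (f n : int) 0.
    by rewrite normr0.
  by case: f0; exists n.
pose P := (\prod_(q <- s) q)%N.
have dvdP p n : prime p -> (p%:Z %| (f n : int))%Z -> (p %| P)%N.
  move=> pp pf; apply: dvdn_prod_seq.
  by rewrite -sE; split=> //; exists n.
have P_gt0 : (0 < P)%N.
  rewrite /P big_seq prodn_cond_gt0 // => p ps.
  by move: ps; rewrite -sE => -[/prime_gt0].
pose m : int := f n0.
have [|b b0 fb] := @continuous_posint_Con f n0 (`|m| * P%:Z) f_continuous.
  by rewrite mulr_gt0 ?normr_gt0.
apply: (f_unbounded (\val n0) b b0); exists `|m| => _ [n /fb + <-].
move=> /eqP; rewrite eqz_mod_dvd => /dvdzP[k fnE].
(* The modulus involves the absolute value of [m], which is [Num.sg m * m]; moving the sign into [u]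
   leaves a multiple of [m] itself. *)
pose u : int := 1 + k * Num.sg m * P%:Z.
have {}fnE : (f n : int) = u * m.
  rewrite -[LHS](subrK m) fnE /u normrEsg; ring.
suff u1 : `|u|%N = 1%N by rewrite fnE normrM -(abszE u) u1 mul1r.
(* The value [u = 0] has not been excluded, but it too has a prime divisor. *)
apply/eqP; apply: contrapT => /negP /prime_dvdn_neq1[p pp pu].
have {}pu : (p%:Z %| u)%Z by rewrite dvdzE.
have pP : (p%:Z %| P%:Z)%Z.
  by apply: (dvdP p n) => //; rewrite fnE dvdz_mulr.
have : (p%:Z %| 1)%Z by move: pu; rewrite rpredDr ?dvdz_mull.
by rewrite dvdz1 /= => /eqP p1; rewrite p1 in pp.
Qed.
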